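(* Let $a=\begin{pmatrix}1&1\\0&1\end{pmatrix}$ and $b=\begin{pmatrix}1&0\\1&0\end{pmatrix}$, let $S$ be the semigroup generated by $\{a,b\}$ under matrix multiplication, and let $\mathcal{T}$ be the lexicographic minimal spanning tree of $S$ with respect to the generating set $\{a,b\}$ and the order $b<a$. Then $$\mathrm{IBN}(\mathcal{T})=\frac12.$$
   Context: Lexicographic minimal spanning tree: the root is the identity matrix $\mathrm{Id}$ (the empty word). Each element of $S$ is represented by the word which is lexicographically smallest (with $b<a$) among all words in the letters $a,b$ of minimal length representing it. The vertices of $\mathcal{T}$ are $\mathrm{Id}$ and the elements of $S$, and each element whose representing word is $s_1\cdots s_n$ ($n\ge1$) is joined by an edge to the element represented by the prefix $s_1\cdots s_{n-1}$. For a rooted tree $\mathcal{T}=(V,E,\varrho)$, $|v|$ is the graph distance from $v$ to the root. For an edge $e$ with endpoints $e^-,e^+$ where $|e^+|=|e^-|+1$, put $|e|=|e^+|$. A cutset is a set $\pi\subset E$ such that every infinite self-avoiding path from $\varrho$ to infinity has exactly one edge in $\pi$; $\Pi$ is the set of all cutsets. The intermediate branching number is $$\mathrm{IBN}(\mathcal{T})=\sup\Big\{\lambda>0:\ \inf_{\pi\in\Pi}\sum_{e\in\pi}\exp(-|e|^{\lambda})>0\Big\},$$ with the convention $\sup\emptyset=0$. *)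

(* Defs.v *)
From HB Require Import structures.
From mathcomp Require Import all_boot all_order all_algebra.
From mathcomp Require Import all_classical all_reals all_analysis.

Set Implicit Arguments.
Unset Strict Implicit.
Unset Printing Implicit Defensive.

Import Order.TTheory GRing.Theory Num.Theory.
Local Open Scope classical_set_scope.
Local Open Scope ring_scope.

(* Acyclicity is "every cycle of pairwise distinct vertices has at most two
   vertices": for a simple graph, size 2 is one edge run back and forth. *)
Record rootedTree := RootedTree {
  vertex :> choiceType;
  adj : rel vertex;
  root : vertex;
  adj_sym : symmetric adj;
  adj_irr : irreflexive adj;
  tree_connected : forall v, exists2 p, path adj root p & last root p = v;
  tree_acyclic : forall c : seq vertex, uniq c -> cycle adj c -> (size c <= 2)%N
}.

Definition walk_length (T : rootedTree) (v : T) (n : nat) : bool :=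
  `[< exists p, [/\ path (@adj T) (root T) p, last (root T) p = v & size p = n] >].

Lemma walk_length_ex (T : rootedTree) (v : T) : exists n, walk_length v n.
Proof.
by have [p pp lp] := tree_connected v; exists (size p); apply/asboolP; exists p.
Qed.

Definition depth (T : rootedTree) (v : T) : nat := ex_minn (walk_length_ex v).

(* In a tree the depths of the endpoints of an edge differ by exactly one, so
   every undirected edge is encoded by exactly one pair (e^-, e^+). *)
Definition edges (T : rootedTree) : set (T * T) :=
  [set e | adj e.1 e.2 /\ depth e.2 = (depth e.1).+1].

Definition edge_depth (T : rootedTree) (e : T * T) : nat := depth e.2.

Definition ray (T : rootedTree) (p : nat -> T) : Prop :=
  [/\ p 0%N = root T, injective p & forall i, adj (p i) (p i.+1)].

Definition traverses (T : rootedTree) (p : nat -> T) (e : T * T) : Prop :=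
  exists i, (p i, p i.+1) = e \/ (p i.+1, p i) = e.

Definition cutsets (T : rootedTree) : set (set (T * T)) :=
  [set pi | pi `<=` @edges T /\
            forall p, ray p -> exists! e, pi e /\ traverses p e].

Definition cutset_sum (R : realType) (T : rootedTree) (lambda : R)
    (pi : set (T * T)) : \bar R :=
  \esum_(e in pi) (expR (- ((edge_depth e)%:R `^ lambda)))%:E.

Definition IBN_set (R : realType) (T : rootedTree) : set R :=
  [set lambda | 0 < lambda /\
    (0 < ereal_inf [set cutset_sum lambda pi | pi in @cutsets T])%E].

(* The case distinction is the convention sup set0 = 0: in the library
   ereal_sup set0 = -oo. *)
Definition IBN (R : realType) (T : rootedTree) : \bar R :=
  if @IBN_set R T == set0 then 0%E
  else ereal_sup [set l%:E | l in @IBN_set R T].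

Definition mat_a : 'M[int]_2 :=
  \matrix_(i, j) nth 0 (nth [::] [:: [:: 1; 1]; [:: 0; 1]] i) j.

Definition mat_b : 'M[int]_2 :=
  \matrix_(i, j) nth 0 (nth [::] [:: [:: 1; 0]; [:: 1; 0]] i) j.

Definition generated_semigroup (G : set 'M[int]_2) : set 'M[int]_2 :=
  smallest [set A | forall x y, A x -> A y -> A (x *m y)] G.

Definition semigroup_ab : set 'M[int]_2 :=
  generated_semigroup [set mat_a; mat_b].

(* The letter a is true and b is false: the order false < true of bool is then
   the order b < a. *)
Definition word := seq bool.

Definition letter_mx (s : bool) : 'M[int]_2 := if s then mat_a else mat_b.

Definition word_mx (w : word) : 'M[int]_2 := \prod_(s <- w) letter_mx s.

Definition lex_le (w w' : word) : bool :=
  ((w : seqlexi bool) <= w')%O.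

Definition represents (w : word) (M : 'M[int]_2) : Prop :=
  word_mx w = M /\
  forall w', word_mx w' = M ->
    (size w < size w')%N \/ (size w = size w' /\ lex_le w w').

Definition lex_vertices : set 'M[int]_2 := [set 1] `|` semigroup_ab.

Definition lex_edge (M N : 'M[int]_2) : Prop :=
  exists w s, represents (rcons w s) N /\ word_mx w = M.

Definition lex_adj : rel lex_vertices :=
  fun u v => `[< lex_edge (val u) (val v) \/ lex_edge (val v) (val u) >].

Lemma word_mx_rcons w s : word_mx (rcons w s) = word_mx w *m letter_mx s.
Proof. by rewrite /word_mx -cats1 big_cat big_seq1. Qed.

Lemma word_mx_vertex w : word_mx w \in lex_vertices.
Proof.
rewrite inE; elim/last_ind: w => [|w s IHw]; first by left; rewrite /word_mx big_nil.
have Ss : semigroup_ab (letter_mx s).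
  by apply: sub_gen_smallest; case: s; [left | right].
right; rewrite word_mx_rcons; case: IHw => [->|Sw]; first by rewrite mul1mx.
by move=> A AP; apply: (AP.1) (Sw A AP) (Ss A AP).
Qed.

Lemma vertex_word M : lex_vertices M -> exists w, word_mx w = M.
Proof.
case=> [->|SM]; first by exists [::]; rewrite /word_mx big_nil.
apply: (SM [set M | exists w, word_mx w = M]); split=> [x y [w <-] [w' <-]|x].
  by exists (w ++ w'); rewrite /word_mx big_cat.
by case=> ->; [exists [:: true] | exists [:: false]];
   rewrite /word_mx big_seq1.
Qed.

Lemma represents_ex M : lex_vertices M -> exists w, represents w M.
Proof.
move=> /vertex_word wM.
have /ex_minnP[n /asboolP[w0 w0M sw0] nmin] :
    exists n, `[< exists2 w, word_mx w = M & size w = n >].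
  by case: wM => w wM; exists (size w); apply/asboolP; exists w.
have sw0' : size w0 == n by apply/eqP.
pose P (t : n.-tuple bool) := word_mx (tval t) == M.
have P0 : P (Tuple sw0') by apply/eqP.
case: (@Order.TotalTheory.arg_minP _ (seqlexi bool) _
        (Tuple sw0') P (fun t => tval t) P0) => t /eqP tM tmin.
exists t; split=> // w' w'M.
have : (n <= size w')%N by apply: nmin; apply/asboolP; exists w'.
rewrite leq_eqVlt => /orP[/eqP nw'|]; last by rewrite size_tuple; left.
right; rewrite size_tuple; split=> //.
have sw' : size w' == n by rewrite -nw'.
by apply: (tmin (Tuple sw')); apply/eqP.
Qed.

Lemma represents_uniq w w' M : represents w M -> represents w' M -> w = w'.
Proof.
move=> [wM wmin] [w'M w'min].
have := wmin _ w'M; have := w'min _ wM.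
rewrite /lex_le => -[lt1|[e1 l1]] [lt2|[e2 l2]].
- by have := ltn_trans lt1 lt2; rewrite ltnn.
- by rewrite e2 ltnn in lt1.
- by rewrite e1 ltnn in lt2.
- by apply: (@le_anti _ (seqlexi bool)); rewrite l1 l2.
Qed.

Lemma lex_le_rcons w w' s :
  size w = size w' -> lex_le (rcons w s) (rcons w' s) -> lex_le w w'.
Proof.
rewrite /lex_le; elim: w w' => [|x w IHw] [|y w'] //= [sw].
rewrite !lexi_cons => /andP[-> /implyP h] /=.
by apply/implyP => /h /(IHw _ sw).
Qed.

Lemma represents_prefix w s M : represents (rcons w s) M -> represents w (word_mx w).
Proof.
move=> [wM wmin]; split=> // w' w'w.
have := wmin (rcons w' s); rewrite !word_mx_rcons w'w -word_mx_rcons wM.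
rewrite !size_rcons ltnS => /(_ erefl) [|[[e] /(lex_le_rcons e)]]; first by left.
by right.
Qed.

Definition lex_root : lex_vertices := SigSub (word_mx_vertex [::]).

Lemma lex_rootE : val lex_root = 1.
Proof. by rewrite /= /word_mx big_nil. Qed.

Lemma lex_adj_sym : symmetric lex_adj.
Proof. by move=> u v; apply/asboolP/asboolP => -[]; [right|left|right|left]. Qed.

Lemma lex_edge_size M N w w' :
  lex_edge M N -> represents w M -> represents w' N -> size w' = (size w).+1.
Proof.
move=> [w0 [s [rN w0M]]] rw /(represents_uniq rN) <-.
have := represents_prefix rN; rewrite w0M => /represents_uniq -/(_ _ rw) ->.
by rewrite size_rcons.
Qed.

Lemma lex_edge_parent M M' N : lex_edge M N -> lex_edge M' N -> M = M'.
Proof.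
move=> [w [s [rN <-]]] [w' [s' [rN' <-]]].
by have /rcons_inj[-> _] := represents_uniq rN rN'.
Qed.

Lemma lex_adj_irr : irreflexive lex_adj.
Proof.
move=> u; apply/asboolP => h.
have {h}e : lex_edge (val u) (val u) by case: h.
have [w rw] := represents_ex (set_mem (valP u)).
by have /eqP := lex_edge_size e rw rw; rewrite -addn1 -[X in X == _]addn0 eqn_add2l.
Qed.

Lemma lex_connected v : exists2 p, path lex_adj lex_root p & last lex_root p = v.
Proof.
have [w rw] := represents_ex (set_mem (valP v)).
elim/last_ind: w v rw => [|w s IHw] v rw.
  by exists [::] => //=; apply: val_inj; rewrite /= -rw.1.
have [p pp lp] := IHw (SigSub (word_mx_vertex w)) (represents_prefix rw).
exists (rcons p v); last by rewrite last_rcons.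
by rewrite rcons_path pp lp; apply/asboolP; left; exists w, s.
Qed.

Lemma lex_acyclic (c : seq lex_vertices) :
  uniq c -> cycle lex_adj c -> (size c <= 2)%N.
Proof.
move=> uc cc; rewrite leqNgt; apply/negP => sc.
have /choice[h hP] (v : lex_vertices) := represents_ex (set_mem (valP v)).
have [x xc xmax] : exists2 x, x \in c &
    forall y, y \in c -> (size (h y) <= size (h x))%N.
  have : (0 < size c)%N by exact: ltn_trans sc.
  elim: c {uc cc sc} => // x [|y c] IHc _.
    by exists x => [|y]; rewrite inE // => /eqP->.
  have [//|z zc zmax] := IHc; have [xz|zx] := leqP (size (h x)) (size (h z)).
    exists z => [|t]; first by rewrite inE zc orbT.
    by rewrite inE => /orP[/eqP->//|]; apply: zmax.
  exists x => [|t]; first by rewrite mem_head.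
  by rewrite inE => /orP[/eqP->//|/zmax tz]; apply: leq_trans tz (ltnW zx).
have up y : y \in c -> lex_adj x y -> lex_edge (val y) (val x).
  move=> yc /asboolP[exy|//]; have := xmax y yc.
  by rewrite (lex_edge_size exy (hP x) (hP y)) ltnn.
have [i p cE] := rot_to xc.
have pc y : y \in p -> y \in c by move=> yp; rewrite -(mem_rot i) cE inE yp orbT.
move: uc cc sc; rewrite -(rot_uniq i) -(rot_cycle i) -(size_rot i) cE.
case: p pc {cE} => [|y [|z q]] //= pc /and3P[_ yzq _] /and3P[xy _].
rewrite rcons_path => /andP[_ lx] _.
have lq : last z q \in z :: q by exact: mem_last.
have exy := up y (pc _ (mem_head _ _)) xy.
have elx : lex_edge (val (last z q)) (val x).
  by apply: up; [apply: pc; rewrite inE lq orbT | rewrite lex_adj_sym].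
have e : y = last z q by apply: val_inj; apply: lex_edge_parent exy elx.
by rewrite e lq in yzq.
Qed.

Definition lex_tree : rootedTree :=
  RootedTree lex_adj_sym lex_adj_irr lex_connected lex_acyclic.

(* Main.v *)
Require Import Defs.
From HB Require Import structures.
From mathcomp Require Import all_boot all_order all_algebra.
From mathcomp Require Import all_classical all_reals all_analysis.
From mathcomp Require Import zify ring lra.

(** Every word in [a] and [b] is either [a^k] or has the form
    [a^i b a^(l_1 - 1) b ... a^(l_n - 1) b a^j] with all [l_k >= 1], and in the
    second case its matrix is [m a^i b a^j] with [m = l_1 ... l_n], because
    [b a^k b = (k + 1) b].  So an element of the semigroup other than a power of
    [a] is a triple [(m, i, j)], and a word for it of minimal length
    comes from a factorization of [m] with the smallest sum of factors.  Prime
    factors have this property ([sum_primes_le]), and in increasing order they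
    give the lexicographically least word ([sorted_primes_min]).

    Upper bound.  A vertex at depth at most [s^2] is determined by [i], [j] and
    a product of parts of total size at most [s^2].  At most [s] of these parts
    exceed [s], and the other ones are known from their multiplicities; this
    leaves [exp(O(s log s))] vertices ([card_vertex_code],
    [decode_vertex_surj]).  If [lambda > 1/2] then this is negligible against
    [exp(s^(2 lambda))], so the cutsets formed by the edges at depth [s^2]
    ([level_cutset]) have arbitrarily small sums ([level_sum_small]).

    Lower bound.  The tree contains all words [b a^(p_1 - 1) b ... b a^j] with
    [p_1 < p_2 < ...] primes.  On the subtree which they form put the unit flow
    that splits evenly at each branching.  There is one branching for each
    prime, so a word in which the primes up to [N] have been decided upon
    carries flow [2^(- primepi N)], while its length is at most [(N + 2)^2].
    By a lower bound of Chebyshev type on [primepi N] ([exp2_le_primepi]) this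
    flow is at most a constant times [exp(- length^lambda)] as soon as
    [lambda < 1/2] ([primepi_growth]).  A cutset whose sum is too small cannot
    intercept the flow: at each vertex where the cutset edges lying below weigh
    less than the flow, the same is true of a child, and following these
    children gives a ray which avoids the cutset ([cutset_sum_ge]). *)

Set Implicit Arguments.
Unset Strict Implicit.
Unset Printing Implicit Defensive.

Import Order.TTheory GRing.Theory Num.Theory.

(** * Words and their matrices *)

(** The word [a^(l - 1) b].  The shift of the exponent makes [l >= 1] both the
    length of the block and the factor by which the block multiplies the matrix
    of a word ending in [b]. *)
Definition block (l : nat) : word := rcons (nseq l.-1 true) false.

Definition tail_word (L : seq nat) (j : nat) : word :=
  flatten [seq block l | l <- L] ++ nseq j true.

Definition block_word (i : nat) (L : seq nat) (j : nat) : word :=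
  nseq i true ++ false :: tail_word L j.

(** The matrix [m a^i b a^j]. *)
Definition triple_mx (m i j : nat) : 'M[int]_2 :=
  \matrix_(r, c) nth 0%R (nth [::]
    [:: [:: Posz (m * i.+1); Posz (m * i.+1 * j)];
        [:: Posz m; Posz (m * j)]] r) c.

Definition power_mx (k : nat) : 'M[int]_2 :=
  \matrix_(r, c) nth 0%R (nth [::] [:: [:: 1%R; Posz k]; [:: 0%R; 1%R]] r) c.

Lemma nseq_rcons (T : Type) n (x : T) : rcons (nseq n x) x = nseq n.+1 x.
Proof. by elim: n => //= n ->. Qed.

Lemma block_word_a i L j :
  rcons (block_word i L j) true = block_word i L j.+1.
Proof.
by rewrite /block_word /tail_word rcons_cat rcons_cons rcons_cat nseq_rcons.
Qed.

Lemma block_word_b i L j :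
  rcons (block_word i L j) false = block_word i (rcons L j.+1) 0.
Proof.
rewrite /block_word /tail_word rcons_cat rcons_cons rcons_cat cats0.
by rewrite map_rcons flatten_rcons.
Qed.

Lemma size_tail_word L j :
  all (leq 1) L -> size (tail_word L j) = sumn L + j.
Proof.
rewrite size_cat size_nseq => L1; congr (_ + _).
elim: L L1 => //= l L IHL /andP[l1 /IHL]; rewrite size_cat => ->.
by rewrite size_rcons size_nseq prednK.
Qed.

Lemma size_block_word i L j :
  all (leq 1) L -> size (block_word i L j) = i + (sumn L + j).+1.
Proof. by move=> L1; rewrite size_cat size_nseq /= size_tail_word. Qed.

Ltac mx2_eq := apply/matrixP => -[[|[|//]] ?] [[|[|//]] ?];
  rewrite !mxE ?big_ord_recl ?big_ord0 ?mxE /=.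

Lemma power_mx_a k : (power_mx k *m mat_a)%R = power_mx k.+1.
Proof. by mx2_eq; lia. Qed.

Lemma power_mx_b k : (power_mx k *m mat_b)%R = triple_mx 1 k 0.
Proof. by mx2_eq; lia. Qed.

Lemma triple_mx_a m i j : (triple_mx m i j *m mat_a)%R = triple_mx m i j.+1.
Proof. by mx2_eq; nia. Qed.

Lemma triple_mx_b m i j : (triple_mx m i j *m mat_b)%R = triple_mx (m * j.+1) i 0.
Proof. by mx2_eq; nia. Qed.

Lemma word_mx_nseq k : word_mx (nseq k true) = power_mx k.
Proof.
elim: k => [|k IHk].
  rewrite /word_mx big_nil; change (scalar_mx 1 = power_mx 0 :> 'M[int]_2).
  by mx2_eq.
by rewrite -nseq_rcons word_mx_rcons IHk power_mx_a.
Qed.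

Lemma word_mx_block_word i L j : all (leq 1) L ->
  word_mx (block_word i L j) = triple_mx (\prod_(l <- L) l) i j.
Proof.
elim/last_ind: L j => [|L l IHL] j L1.
  elim: j => [|j IHj].
    rewrite /block_word cats1 word_mx_rcons word_mx_nseq power_mx_b.
    by rewrite big_nil.
  by rewrite -block_word_a word_mx_rcons IHj triple_mx_a.
move: L1; rewrite all_rcons => /andP[l1 L1].
elim: j => [|j IHj].
  rewrite -(prednK l1) -block_word_b word_mx_rcons (IHL _ L1) triple_mx_b.
  by rewrite prednK // -cats1 big_cat big_seq1.
by rewrite -block_word_a word_mx_rcons IHj triple_mx_a.
Qed.

Lemma word_shape (w : word) : (exists k, w = nseq k true) \/
  exists i L j, all (leq 1) L /\ w = block_word i L j.
Proof.
elim/last_ind: w => [|w s IHw]; first by left; exists 0.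
case: IHw => [[k ->]|[i [L [j [L1 ->]]]]]; case: s.
- by left; exists k.+1; rewrite nseq_rcons.
- by right; exists k, [::], 0; rewrite /block_word cats1.
- by right; exists i, L, j.+1; rewrite block_word_a.
- right; exists i, (rcons L j.+1), 0.
  by rewrite block_word_b all_rcons.
Qed.

Lemma triple_mx_inj m i j m' i' j' : 0 < m ->
  triple_mx m i j = triple_mx m' i' j' -> [/\ m = m', i = i' & j = j'].
Proof.
move=> m0 /matrixP e.
have := e 0%R 0%R; have := e 1%R 0%R; have := e 1%R 1%R; rewrite !mxE /=.
move=> -[e11] -[e10] -[e00]; rewrite -e10 in e11 e00.
split=> //; apply/eqP.
  by rewrite -eqSS -(eqn_pmul2l m0); apply/eqP.
by rewrite -(eqn_pmul2l m0); apply/eqP.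
Qed.

Lemma power_mx_neq_triple k m i j : 0 < m -> power_mx k <> triple_mx m i j.
Proof. by move=> m0 /matrixP/(_ 1%R 0%R); rewrite !mxE /= => -[]; lia. Qed.

Lemma all_leq1_prod_gt0 (L : seq nat) : all (leq 1) L -> 0 < \prod_(l <- L) l.
Proof. by move=> L1; rewrite big_seq prodn_cond_gt0 // => l /(allP L1). Qed.

Lemma prime_dvd_prod_mem p (L : seq nat) : prime p ->
  p %| \prod_(l <- L) l -> exists2 l, l \in L & p %| l.
Proof.
move=> pp; elim: L => [|x s IHs].
  by rewrite big_nil dvdn1 => /eqP p1; rewrite p1 in pp.
rewrite big_cons Euclid_dvdM // => /orP[px|/IHs[l ls pl]].
  by exists x; rewrite ?mem_head.
by exists l; rewrite // inE ls orbT.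
Qed.

(** Splitting a product into primes minimizes the sum of the factors, since
    [p + q <= p * q] for [p, q >= 2].  Dividing a factor of [L] by a prime of [P]
    may produce a factor [1], which would spoil this inequality: factors [1]
    are left out of the sum so that the induction goes through. *)
Lemma sum_primes_le (P L : seq nat) : all prime P -> all (leq 1) L ->
  \prod_(l <- L) l = \prod_(p <- P) p ->
  sumn P <= \sum_(l <- L | l != 1) l.
Proof.
elim: P L => [//|p P IHP] L /= /andP[pp PP] L1; rewrite big_cons => e.
have [l lL pl] : exists2 l, l \in L & p %| l.
  by apply: prime_dvd_prod_mem; rewrite // e dvdn_mulr.
have p0 : 0 < p by exact: prime_gt0.
have l0 := allP L1 _ lL.
have lp0 : 0 < l %/ p by rewrite divn_gt0 // dvdn_leq.
have L'1 : all (leq 1) (l %/ p :: rem l L).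
  by rewrite /= lp0; apply/allP => x /mem_rem; apply: (allP L1).
have e' : \prod_(x <- l %/ p :: rem l L) x = \prod_(p <- P) p.
  apply/eqP; rewrite -(eqn_pmul2l p0) -e (perm_big _ (perm_to_rem lL)) /=.
  by rewrite !big_cons mulnA muln_divCA // divnn p0 muln1.
have := IHP _ PP L'1 e'; rewrite (perm_big _ (perm_to_rem lL)) /= !big_cons.
have p2 := prime_gt1 pp.
have := divnK pl; set q := l %/ p in lp0 *; set x := \sum_(_ <- _ | _) _ => lE.
rewrite -lE; have -> : (q * p != 1) by nia.
case: eqP => [->|q1] /= h; first by rewrite mul1n leq_add2l.
have : p + q <= q * p by nia.
lia.
Qed.

Lemma lex_le_cons (x : bool) (w w' : word) :
  lex_le (x :: w) (x :: w') = lex_le w w'.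
Proof. by rewrite /lex_le lexi_cons lexx. Qed.

Lemma lex_le_cat (u w w' : word) : lex_le (u ++ w) (u ++ w') = lex_le w w'.
Proof. by elim: u => //= x u; rewrite lex_le_cons. Qed.

Lemma lex_le_refl (w : word) : lex_le w w.
Proof. by rewrite /lex_le lexx. Qed.

Lemma tail_word_cons l L j : tail_word (l :: L) j = block l ++ tail_word L j.
Proof. by rewrite /tail_word /= catA. Qed.

Lemma sum_neq1_le (L : seq nat) : \sum_(l <- L | l != 1) l <= sumn L.
Proof. by rewrite sumnE [X in _ <= X](bigID (fun l => l != 1)) leq_addr. Qed.

(** By [sum_primes_le] only the lexicographic order is at stake, and the first
    factor [l] of [L] decides it, unless [l] is the smallest prime [p]: for
    [l > p] the word of [L] is larger, as [b < a]; for [l = 1] the sum is not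
    minimal; and no [l] strictly between [1] and [p] divides the product. *)
Lemma sorted_primes_min (P L : seq nat) j :
  all prime P -> sorted leq P -> all (leq 1) L ->
  \prod_(l <- L) l = \prod_(p <- P) p ->
  sumn P < sumn L \/
  (sumn P = sumn L /\ lex_le (tail_word P j) (tail_word L j)).
Proof.
elim: P L => [|p P IHP] L PP Ps L1 e.
  case: L L1 e => [|l L] L1 e; [right|left]; first by rewrite lex_le_refl.
  by move: L1 => /= /andP[l1 _]; apply: leq_trans (leq_addr _ _).
have le_sum := leq_trans (sum_primes_le PP L1 e) (sum_neq1_le L).
case: L L1 e le_sum => [|l L].
  rewrite big_nil big_cons => _ /esym/eqP; rewrite muln_eq1 => /andP[/eqP p1 _].
  by rewrite p1 in PP.
move=> /= /andP[l1 L1] e le_sum; move: PP => /= /andP[pp PP].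
have [lp|pl|lp] := ltngtP l p.
- have [l1'|l1'] := eqVneq l 1.
    left; have e' : \prod_(x <- L) x = \prod_(x <- p :: P) x.
      by rewrite -e big_cons l1' mul1n.
    have pPP : all prime (p :: P) by rewrite /= pp.
    have h := sum_primes_le pPP L1 e'.
    by apply: leq_ltn_trans (leq_trans h (sum_neq1_le L)) _; rewrite l1'.
  have l2 : 1 < l by rewrite ltn_neqAle eq_sym l1'.
  have [|q qP lq] := @prime_dvd_prod_mem (pdiv l) (p :: P) (pdiv_prime l2).
    by rewrite -e big_cons dvdn_mulr // pdiv_dvd.
  have /allP pP : all (leq p) P by apply: order_path_min Ps; apply: leq_trans.
  have pq : p <= q by move: qP; rewrite inE => /orP[/eqP->//|/pP].
  have qp : prime q by move: qP; rewrite inE => /orP[/eqP->//|/(allP PP)].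
  move: lq; rewrite dvdn_prime2 ?pdiv_prime // => /eqP lq.
  by have := pdiv_leq l1; rewrite lq; lia.
- case: (ltngtP (p + sumn P) (l + sumn L)) le_sum => // e' _; [by left|right].
  split=> //; rewrite !tail_word_cons /block.
  have -> : l.-1 = p.-1 + (l.-1 - p.-1).-1.+1.
    by have := prime_gt0 pp; lia.
  by rewrite nseqD !cat_rcons -catA lex_le_cat /= /lex_le lexi_cons.
- move: e; rewrite !big_cons lp => /eqP; rewrite eqn_pmul2l ?prime_gt0//.
  move=> /eqP /(IHP L PP (path_sorted Ps) L1) [h|[h h']]; [left|right].
    by rewrite ltn_add2l.
  by rewrite h !tail_word_cons lex_le_cat.
Qed.

Lemma all_prime_leq1 P : all prime P -> all (leq 1) P.
Proof. by apply: sub_all => p /prime_gt0. Qed.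

Lemma represents_primes P j : all prime P -> sorted leq P ->
  represents (block_word 0 P j) (word_mx (block_word 0 P j)).
Proof.
move=> PP Ps; split=> // w'; have P1 := all_prime_leq1 PP.
rewrite (word_mx_block_word _ _ P1).
case: (word_shape w') => [[k ->]|[i [L [j' [L1 ->]]]]].
  rewrite word_mx_nseq => /power_mx_neq_triple h; case: h.
  exact: all_leq1_prod_gt0.
rewrite (word_mx_block_word _ _ L1) => /triple_mx_inj[].
  exact: all_leq1_prod_gt0.
move=> e -> ->; rewrite !size_block_word // !add0n !ltnS ltn_add2r.
case: (sorted_primes_min j PP Ps L1 e) => [|[-> h]]; [by left | right].
by split=> //; rewrite /block_word lex_le_cat lex_le_cons.
Qed.

(** * The number of vertices at depth s^2 *)

(** A code consists of a flag for the powers of [a], the exponents [i] and [j],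
    the multiplicities of the parts at most [s], and a list of [s] further
    parts, shifted by one, in which [1] serves as padding. *)
Definition vertex_code (s : nat) : Type :=
  (bool * 'I_(s ^ 2).+1 * 'I_(s ^ 2).+1
   * {ffun 'I_s -> 'I_(s ^ 2).+1} * {ffun 'I_s -> 'I_(s ^ 2).+1})%type.

Definition decode_vertex (s : nat) (c : vertex_code s) : 'M[int]_2 :=
  let: (is_power, i, j, f, g) := c in
  if is_power then power_mx i
  else triple_mx
    ((\prod_(k : 'I_s) k.+1 ^ f k) * \prod_(k : 'I_s) (g k).+1) i j.

Lemma card_vertex_code s : #|{: vertex_code s}| = 2 * (s ^ 2).+1 ^ (s + s).+2.
Proof.
by rewrite !card_prod !card_ffun !card_ord card_bool !expnS expnD; ring.
Qed.

Lemma prod_small_parts (s : nat) (L : seq nat) : all (leq 1) L ->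
  \prod_(l <- L | l <= s) l = \prod_(k < s) k.+1 ^ count_mem k.+1 L.
Proof.
elim: L => [|l L IHL] /=.
  by rewrite big_nil big1 // => k _; rewrite expn0.
move=> /andP[l1 /IHL {}IHL]; rewrite big_cons IHL; case: ifP => ls.
  have ls' : l.-1 < s by rewrite prednK.
  under [RHS]eq_bigr do rewrite expnD.
  rewrite big_split /=; congr (_ * _).
  rewrite (bigD1 (Ordinal ls')) //= prednK // eqxx expn1 big1 ?muln1 //.
  move=> k; rewrite -val_eqE /= => kl.
  by have [e|//] := eqVneq l k.+1; rewrite e eqxx in kl.
apply: eq_bigr => k _; case: eqP => // e.
by move: ls; rewrite e ltn_ord.
Qed.

Lemma count_mem_le_sumn k (L : seq nat) : count_mem k.+1 L <= sumn L.
Proof. by elim: L => //= l L IHL; apply: leq_add => //; case: eqP => // ->. Qed.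

(** More than [s] parts larger than [s] would add up to more than [s^2]. *)
Lemma size_large_parts s (L : seq nat) : sumn L <= s ^ 2 ->
  size [seq l <- L | s < l] <= s.
Proof.
move=> Ls; have : size [seq l <- L | s < l] * s.+1 <= sumn L.
  elim: (L) => //= l t IHt; case: ifP => /= sl; first by rewrite mulSn leq_add.
  exact: leq_trans IHt (leq_addl _ _).
move=> h; have := leq_trans h Ls; set z := size _.
by case: (leqP z s) => // sz; nia.
Qed.

Lemma prod_nth_pad (s : nat) (B : seq nat) : size B <= s ->
  \prod_(l <- B) l = \prod_(k < s) nth 1 B k.
Proof.
move=> Bs; rewrite (big_nth 1) big_mkord.
rewrite (big_ord_widen s (fun k => nth 1 B k) Bs).
rewrite [RHS](bigID (fun k : 'I_s => k < size B)) /=.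
rewrite [X in _ = _ * X]big1 ?muln1 //.
by move=> k; rewrite -leqNgt => ?; rewrite nth_default.
Qed.

Lemma nth_le_sumn (B : seq nat) k : nth 1 B k <= (sumn B).+1.
Proof.
elim: B k => [|l B IHB] [|k] //=; first by rewrite -addnS leq_addr.
by apply: leq_trans (IHB k) _; rewrite ltnS leq_addl.
Qed.

(** The product of the block sizes splits into the parts at most [s], counted
    with multiplicity, and the larger ones, padded to a list of length [s]. *)
Lemma decode_vertex_surj s (w : word) : size w <= s ^ 2 ->
  exists c : vertex_code s, word_mx w = decode_vertex c.
Proof.
set n := s ^ 2.
case: (word_shape w) => [[k ->]|[i [L [j [L1 ->]]]]].
  rewrite size_nseq word_mx_nseq => kn.
  exists (true, inord k, ord0, [ffun=> ord0], [ffun=> ord0]).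
  by rewrite /= inordK.
rewrite (size_block_word _ _ L1) (word_mx_block_word _ _ L1) => sz.
pose B := [seq l <- L | s < l].
exists (false, inord i, inord j,
  [ffun k : 'I_s => inord (count_mem k.+1 L)],
  [ffun k : 'I_s => inord (nth 1 B k).-1]) => /=.
rewrite !inordK; try lia.
congr triple_mx; rewrite (bigID (fun l => l <= s)) /= prod_small_parts //.
congr (_ * _).
  apply: eq_bigr => k _; rewrite ffunE inordK //.
  rewrite ltnS; apply: leq_trans (count_mem_le_sumn _ _) _.
  by rewrite -/n in sz; lia.
under eq_bigl do rewrite -ltnNge.
rewrite -big_filter -/B (@prod_nth_pad s); last by apply: size_large_parts; lia.
apply: eq_bigr => k _; rewrite ffunE.
have B1 : all (leq 1) B.
  by rewrite all_filter; apply: sub_all L1 => l l0 /=; rewrite l0 implybT.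
have nth0 : 0 < nth 1 B k.
  case: (ltnP k (size B)) => kB; last by rewrite nth_default.
  by apply: (allP B1); exact: mem_nth.
have sBL : sumn B <= sumn L.
  rewrite /B; elim: (L) => //= l t IHt; case: ifP => _ /=.
    by rewrite leq_add2l.
  exact: leq_trans IHt (leq_addl _ _).
have := nth_le_sumn B k => h.
by rewrite inordK ?prednK //; lia.
Qed.

(** * A lower bound for the number of primes *)

Definition primepi (n : nat) : nat := \sum_(1 <= p < n.+1) prime p.

Lemma primepiS n : primepi n.+1 = primepi n + prime n.+1.
Proof. by rewrite /primepi big_nat_recr. Qed.

Lemma leq_primepi m n : m <= n -> primepi m <= primepi n.
Proof.
elim: n => [|n IHn]; first by rewrite leqn0 => /eqP->.
rewrite leq_eqVlt => /orP[/eqP->//|/IHn h].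
by rewrite primepiS; apply: leq_trans h (leq_addr _ _).
Qed.

(** By Legendre's formula the exponent is the sum over [k >= 1] of
    [2n %/ p^k - 2 * (n %/ p^k)]; each term is at most [1] and vanishes when
    [p^k > 2n]. *)
Lemma logn_central_bin p n : prime p -> 0 < n ->
  logn p 'C(n + n, n) <= trunc_log p (n + n).
Proof.
move=> pp n0; have C0 : 0 < 'C(n + n, n) by rewrite bin_gt0 leq_addr.
have : logn p ((n + n)`!) = logn p 'C(n + n, n) + (logn p n`! + logn p n`!).
  rewrite -(bin_fact (leq_addr n n)) addKn.
  by rewrite !lognM ?muln_gt0 ?fact_gt0.
rewrite !logn_fact //.
have wid : \sum_(1 <= k < n.+1) n %/ p ^ k =
           \sum_(1 <= k < (n + n).+1) n %/ p ^ k.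
  rewrite [RHS](@big_cat_nat _ _ _ n.+1) //=; last by rewrite ltnS leq_addr.
  rewrite [X in _ = _ + X]big_nat_cond [X in _ = _ + X]big1 ?addn0 // => k.
  move=> /andP[/andP[nk _] _]; apply: divn_small.
  by apply: leq_trans nk _; apply: ltnW; apply: ltn_expl; apply: prime_gt1.
rewrite wid => e.
set t := trunc_log p (n + n).
have t1 : t <= n + n.
  apply: ltnW; apply: leq_trans (ltn_expl t (prime_gt1 pp)) _.
  by apply: trunc_logP; rewrite ?prime_gt1 ?addn_gt0 ?n0.
have : \sum_(1 <= k < (n + n).+1) (n + n) %/ p ^ k <=
   \sum_(1 <= k < (n + n).+1) (k <= t) +
   (\sum_(1 <= k < (n + n).+1) n %/ p ^ k +
    \sum_(1 <= k < (n + n).+1) n %/ p ^ k).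
  rewrite -!big_split /=; apply: leq_sum => k _.
  have pk0 : 0 < p ^ k by rewrite expn_gt0 prime_gt0.
  case: (leqP k t) => kt.
    rewrite divnD //; case: leqP; lia.
  rewrite divn_small // ltnNge; apply/negP => /(trunc_log_max (prime_gt1 pp)).
  by rewrite leqNgt kt.
rewrite e leq_add2r => h; apply: leq_trans h _.
rewrite (@big_cat_nat _ _ _ t.+1) //=.
rewrite [X in _ + X]big_nat_cond [X in _ + X]big1 ?addn0; last first.
  by move=> k /andP[/andP[tk _] _]; rewrite leqNgt tk.
apply: (@leq_trans (\sum_(1 <= k < t.+1) 1)).
  by apply: leq_sum => k _; apply: leq_b1.
by rewrite sum_nat_const_nat muln1 subSS subn0.
Qed.

(** The central binomial coefficient is at least [2^n], and each of its prime
    power factors is at most [2n]. *)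
Lemma exp2_le_primepi n : 0 < n -> 2 ^ n <= (n + n) ^ primepi (n + n).
Proof.
move=> n0; set m := n + n.
have C0 : 0 < 'C(m, n) by rewrite bin_gt0 leq_addr.
apply: (@leq_trans 'C(m, n)).
  (* ['C(2n, n)] is the sum of the squares of the ['C(n, j)] *)
  rewrite /m -binomial.Vandermonde.
  apply: (@leq_trans (\sum_(j < n.+1) 'C(n, j))).
    by have := expnDn 1 1 n; under eq_bigr do rewrite !exp1n !muln1; move=> <-.
  apply: leq_sum => j _; apply: leq_pmulr; rewrite bin_gt0; exact: leq_subr.
rewrite -[X in X <= _](partnT C0) (@widen_partn (maxn 'C(m, n) m)) ?leq_maxl //=.
have logn_le p : prime p -> logn p 'C(m, n) <= trunc_log p m.
  by move=> pp; apply: logn_central_bin.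
rewrite (@big_cat_nat _ _ _ m.+1) //=; last by rewrite ltnS leq_maxr.
rewrite [X in _ * X]big_nat_cond [X in _ * X]big1 ?muln1; last first.
  move=> p /andP[/andP[mp _] _]; have [pp|pp] := boolP (prime p); last first.
    by rewrite lognE (negPf pp).
  have := logn_le p pp; have -> : trunc_log p m = 0; last by case: logn.
  apply/eqP; rewrite trunc_log_eq0; apply/orP; right.
  by move: mp; rewrite -/m; lia.
rewrite big_ltn // lognE /= expn0 mul1n /primepi expn_sum.
apply: leq_prod => p _; have [pp|pp] := boolP (prime p); last first.
  by rewrite lognE (negPf pp).
rewrite expn1; apply: leq_trans (trunc_logP (prime_gt1 pp) _).
  by rewrite leq_exp2l ?prime_gt1 ?logn_le.
by rewrite addn_gt0 n0.
Qed.

(** * Depths and rays in the spanning tree *)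

Local Open Scope classical_set_scope.
Local Open Scope ring_scope.

Definition lex_mx (v : lex_tree) : 'M[int]_2 := val (v : lex_vertices).

Lemma lex_mx_inj : injective lex_mx.
Proof. exact: val_inj. Qed.

Lemma lex_mx_represents v : exists w, represents w (lex_mx v).
Proof. exact: represents_ex (set_mem (valP v)). Qed.

Lemma adj_lexP (u v : lex_tree) :
  reflect (lex_edge (lex_mx u) (lex_mx v) \/ lex_edge (lex_mx v) (lex_mx u))
          (adj u v).
Proof. exact: asboolP. Qed.

Lemma represents_nil : represents [::] 1.
Proof.
split; first by rewrite /word_mx big_nil.
by case=> [_|x w _]; [right | left].
Qed.

Lemma walk_to_word w : represents w (word_mx w) ->
  exists p : seq lex_tree,
    [/\ path (@adj lex_tree) (Defs.root lex_tree) p,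
        lex_mx (last (Defs.root lex_tree) p) = word_mx w & size p = size w].
Proof.
elim/last_ind: w => [|w s IHw] rw.
  by exists [::].
have [p [pp lp sp]] := IHw (represents_prefix rw).
pose v : lex_tree := SigSub (word_mx_vertex (rcons w s)).
exists (rcons p v); rewrite last_rcons !size_rcons sp rcons_path pp; split=> //.
by apply/adj_lexP; left; exists w, s; split.
Qed.

Lemma path_size_le (u v : lex_tree) p wu wv :
  path (@adj lex_tree) u p -> last u p = v ->
  represents wu (lex_mx u) -> represents wv (lex_mx v) ->
  (size wv <= size wu + size p)%N.
Proof.
elim: p u wu => [|x p IHp] u wu /= => [_ <- ru rv|].
  by rewrite (represents_uniq ru rv) addn0.
move=> /andP[/adj_lexP ux xp] lp ru rv.
have [wx rx] := lex_mx_represents x.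
have := IHp _ _ xp lp rx rv.
case: ux => e; have := lex_edge_size e.
  by move=> /(_ _ _ ru rx) ->; rewrite addSnnS.
move=> /(_ _ _ rx ru) -> h; apply: leq_trans h _.
by rewrite addSnnS leq_add2l ltnW.
Qed.

(** The prefixes of the representing word form a walk of this length; no walk is
    shorter, because the size changes by one along each edge. *)
Lemma depth_lex v w : represents w (lex_mx v) -> depth v = size w.
Proof.
move=> rw; rewrite /depth; case: ex_minnP => n /asboolP[p [pp lp <-]] nmin.
have r0 : represents [::] (lex_mx (Defs.root lex_tree)).
  by rewrite /lex_mx /= /word_mx big_nil; exact: represents_nil.
apply/eqP; rewrite eqn_leq; apply/andP; split; last first.
  exact: path_size_le pp lp r0 rw.
have rw' : represents w (word_mx w) by rewrite rw.1.
apply: nmin; apply/asboolP; have [q [pq lq sq]] := walk_to_word rw'.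
by exists q; split=> //; apply: lex_mx_inj; rewrite lq rw.1.
Qed.

Lemma lex_edge_depth (u v : lex_tree) :
  lex_edge (lex_mx u) (lex_mx v) -> depth v = (depth u).+1.
Proof.
have [wu ru] := lex_mx_represents u; have [wv rv] := lex_mx_represents v.
by move=> e; rewrite (depth_lex ru) (depth_lex rv); apply: lex_edge_size e ru rv.
Qed.

Lemma lex_edgesP (u v : lex_tree) :
  @edges lex_tree (u, v) <-> lex_edge (lex_mx u) (lex_mx v).
Proof.
split=> [[/adj_lexP[//|/lex_edge_depth /= -> /=]]|e]; first by lia.
by split; [apply/adj_lexP; left | exact: lex_edge_depth].
Qed.

(** A ray never steps towards the root: a first such step would lead back to the
    parent, where the ray has just come from. *)
Lemma ray_lex_edge (p : nat -> lex_tree) i :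
  ray p -> lex_edge (lex_mx (p i)) (lex_mx (p i.+1)).
Proof.
move=> [p0 pinj padj]; elim: i => [|i IHi].
  have /adj_lexP[//|/lex_edge_depth] := padj 0%N.
  have -> : depth (p 0%N) = 0%N; last by [].
  rewrite p0 (@depth_lex _ [::]) // /lex_mx /= /word_mx big_nil.
  exact: represents_nil.
have /adj_lexP[//|e] := padj i.+1.
by have /lex_mx_inj/pinj := lex_edge_parent IHi e; lia.
Qed.

Lemma ray_depth (p : nat -> lex_tree) i : ray p -> depth (p i) = i.
Proof.
move=> rp; elim: i => [|i IHi].
  have [-> _ _] := rp; rewrite (@depth_lex _ [::]) // /lex_mx /= /word_mx big_nil.
  exact: represents_nil.
by rewrite (lex_edge_depth (ray_lex_edge i rp)) IHi.
Qed.

Lemma ray_traverses (p : nat -> lex_tree) e : ray p -> @edges lex_tree e ->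
  traverses p e -> exists i, e = (p i, p i.+1).
Proof.
move=> rp [_ de] [i [<-|ei]]; first by exists i.
by move: de; rewrite -ei /= !(ray_depth _ rp); lia.
Qed.

Definition level (n : nat) : set (lex_tree * lex_tree) :=
  [set e | edges e /\ edge_depth e = n].

Lemma level_cutset n : @cutsets lex_tree (level n.+1).
Proof.
split=> [e []//|p rp]; exists (p n, p n.+1); split.
  split; last by exists n; left.
  by split; [apply/lex_edgesP; exact: ray_lex_edge | exact: ray_depth].
move=> e [[ee en] /(ray_traverses rp ee)[i ei]].
by move: en; rewrite ei /edge_depth /= (ray_depth _ rp) => -[->].
Qed.

(** An edge is determined by its endpoint farther from the root, so the number of
    terms is at most the number of vertices at this depth. *)
Lemma level_sum_le (R : realType) (lambda : R) s :
  (cutset_sum lambda (level (s ^ 2)) <=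
   ((2 * (s ^ 2).+1 ^ (s + s).+2)%:R * expR (- ((s ^ 2)%:R `^ lambda)))%:E)%E.
Proof.
set v := expR _; set K := (2 * _)%N.
have v0 : 0 <= v by exact: expR_ge0.
apply: ge_ereal_sup => _ [A [finA AX] <-].
rewrite (eq_fsbigr (fun=> v%:E)); last first.
  by move=> e /set_mem/AX [_ ->].
rewrite fsbig_finite //= sumEFin lee_fin big_const_seq count_predT iter_addr_0.
rewrite -[v *+ _]mulr_natl ler_wpM2r // ler_nat.
have /choice[f fP] (e : lex_tree * lex_tree) :
    exists c : vertex_code s, A e -> lex_mx e.2 = decode_vertex c.
  have [Ae|nAe] := pselect (A e); last first.
    by have [c _] := @decode_vertex_surj s [::] (leq0n _); exists c.
  have [w rw] := lex_mx_represents e.2.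
  have [|c cw] := @decode_vertex_surj s w.
    by have [_ <-] := AX _ Ae; rewrite /edge_depth (depth_lex rw).
  by exists c => _; rewrite -cw rw.1.
have /card_uniqP : uniq [seq f e | e <- finmap.enum_fset (fset_set A)].
  rewrite map_inj_in_uniq; first exact: finmap.fset_uniq.
  move=> -[u1 v1] [u2 v2].
  rewrite !in_fset_set // => /set_mem A1 /set_mem A2 ef.
  have e12 : v1 = v2 by apply: lex_mx_inj; rewrite (fP _ A1) (fP _ A2) ef.
  have [/lex_edgesP e1 _] := AX _ A1; have [/lex_edgesP e2 _] := AX _ A2.
  by rewrite e12 in e1 *; rewrite (lex_mx_inj (lex_edge_parent e1 e2)).
by rewrite size_map => <-; rewrite /K -card_vertex_code; apply: max_card.
Qed.

(** * Descending along primes *)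

Definition word_vertex (w : word) : lex_tree := SigSub (word_mx_vertex w).

Lemma lex_mx_word_vertex w : lex_mx (word_vertex w) = word_mx w.
Proof. by []. Qed.

Lemma word_ray (w : nat -> word) : w 0%N = [::] ->
  (forall n, represents (w n) (word_mx (w n))) ->
  (forall n, exists s, w n.+1 = rcons (w n) s) ->
  ray (fun n => word_vertex (w n)).
Proof.
move=> w0 rw wS; have sw n : size (w n) = n.
  elim: n => [|n IHn]; first by rewrite w0.
  by have [s ->] := wS n; rewrite size_rcons IHn.
split=> [|m n /(congr1 (@lex_mx))|n].
- by rewrite w0.
- rewrite !lex_mx_word_vertex => e; have rm := rw m; rewrite e in rm.
  by rewrite -(sw m) -(sw n) (represents_uniq rm (rw n)).
- apply/adj_lexP; left; have [s ws] := wS n.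
  by exists (w n), s; rewrite !lex_mx_word_vertex -ws.
Qed.

(** The edge leading to the vertex of [w] itself is counted as lying below [w]. *)
Definition below (w : word) : set (lex_tree * lex_tree) :=
  [set e | exists2 w', prefix w w' & represents w' (lex_mx e.2)].

Lemma below_rcons w s : below (rcons w s) `<=` below w.
Proof.
move=> e [w' pw rw]; exists w' => //; apply: prefix_trans pw.
exact: prefix_rcons.
Qed.

Lemma below_rcons_disj w e :
  below (rcons w true) e -> below (rcons w false) e -> False.
Proof.
move=> [w1 p1 r1] [w2 p2 r2]; rewrite (represents_uniq r1 r2) in p1.
case/prefixP: p1 => u1 e1; case/prefixP: p2 => u2 e2.
by move: e2; rewrite e1 !cat_rcons => /eqP; rewrite eqseq_cat // eqxx.
Qed.

(** The state [(P, j)] stands for the word [b a^(p_1 - 1) b ... a^(p_n - 1) b a^j]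
    where [P = p_1, ..., p_n].  In it every prime up to [state_max] has been
    either used or passed over. *)
Definition state : Type := (seq nat * nat)%type.
Definition state_word (x : state) : word := block_word 0 x.1 x.2.
Definition state_max (x : state) : nat := maxn (last 0%N x.1) x.2.
Definition state_ok (x : state) : bool := all prime x.1 && sorted ltn x.1.

Lemma state_represents x : state_ok x ->
  represents (state_word x) (word_mx (state_word x)).
Proof.
move=> /andP[xp xs]; apply: represents_primes => //.
by apply: sub_sorted xs => m n; apply: ltnW.
Qed.

Lemma sumn_sorted_le (P : seq nat) :
  sorted ltn P -> (2 * sumn P <= last 0 P * (last 0 P).+1)%N.
Proof.
elim/last_ind: P => // P p IHP.
rewrite sumn_rcons last_rcons => sP.
have {}IHP := IHP (subseq_sorted ltn_trans (subseq_rcons P p) sP).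
have : (last 0 P < p)%N \/ P = [::].
  case: (P) sP => [|x s]; first by right.
  by rewrite /= rcons_path => /andP[_]; left.
by move=> [h|->] /=; nia.
Qed.

Lemma size_state_word x : state_ok x ->
  (size (state_word x) <= (state_max x).+2 ^ 2)%N.
Proof.
move=> /andP[xp xs]; rewrite size_block_word ?all_prime_leq1 //.
have := sumn_sorted_le xs; rewrite /state_max.
have := leq_maxl (last 0%N x.1) x.2; have := leq_maxr (last 0%N x.1) x.2.
by set N := maxn _ _; set l := last _ _; nia.
Qed.

Lemma cutset_sum_ge0 (R : realType) (T : rootedTree) (lambda : R)
    (A : set (T * T)) : (0 <= cutset_sum lambda A)%E.
Proof. by apply: esum_ge0 => e _; rewrite lee_fin expR_ge0. Qed.

Lemma le_cutset_sum (R : realType) (T : rootedTree) (lambda : R)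
    (A B : set (T * T)) :
  A `<=` B -> (cutset_sum lambda A <= cutset_sum lambda B)%E.
Proof.
move=> AB; rewrite [leRHS]/cutset_sum (esumID A); last first.
  by move=> e _; rewrite lee_fin expR_ge0.
by rewrite setIidr // leeDl // cutset_sum_ge0.
Qed.

Definition mass_below (R : realType) (lambda : R)
    (pi : set (lex_tree * lex_tree)) (w : word) : \bar R :=
  cutset_sum lambda (pi `&` below w).

Lemma mass_below_children (R : realType) (lambda : R) pi w :
  (mass_below lambda pi (rcons w true) + mass_below lambda pi (rcons w false)
   <= mass_below lambda pi w)%E.
Proof.
rewrite [leRHS]/mass_below /cutset_sum.
rewrite (esumID (below (rcons w true))); last first.
  by move=> e _; rewrite lee_fin expR_ge0.
apply: leeD; apply: le_cutset_sum => e [pe be]; split=> //.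
- by split=> //; apply: below_rcons be.
- by split=> //; apply: below_rcons be.
- by move=> be'; apply: below_rcons_disj be' be.
Qed.

Definition primepi_dominates (R : realType) (lambda C : R) : Prop :=
  forall N d : nat, (d <= N.+2 ^ 2)%N ->
    d%:R `^ lambda <= (primepi N)%:R * ln 2 + C.

(** The flow [2^(- primepi N)] through the vertex of the state, scaled by
    [exp(- C)]. *)
Definition state_flow (R : realType) (C : R) (x : state) : R :=
  expR (- ((primepi (state_max x))%:R * ln 2 + C)).

(** The edge leading to the vertex of the state weighs at least as much as the
    flow through it, so a cutset containing this edge has enough mass there. *)
Lemma state_flow_le_mass (R : realType) (lambda C : R) pi x e :
  primepi_dominates lambda C -> state_ok x -> pi e ->
  e.2 = word_vertex (state_word x) ->
  ((state_flow C x)%:E <= mass_below lambda pi (state_word x))%E.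
Proof.
move=> lambdaC okx pe ex; have rx := state_represents okx.
have re : represents (state_word x) (lex_mx e.2) by rewrite ex.
apply: (@le_trans _ _ (cutset_sum lambda [set e])); last first.
  apply: le_cutset_sum => _ ->; split=> //.
  by exists (state_word x); rewrite ?prefix_refl.
rewrite /cutset_sum esum_set1 ?lee_fin ?expR_ge0 // ler_expR lerN2.
by rewrite /edge_depth (depth_lex re); apply/lambdaC/size_state_word.
Qed.

(** Appending [b] to the state [(P, j)] is allowed when [j + 1] is a prime beyond
    [P]; then the flow splits into two equal halves.  Otherwise the whole flow
    goes to the child obtained by appending [a]. *)
Lemma mass_deficit_child (R : realType) (lambda C : R) pi x : state_ok x ->
  (mass_below lambda pi (state_word x) < (state_flow C x)%:E)%E ->
  exists y, [/\ state_ok y,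
    (mass_below lambda pi (state_word y) < (state_flow C y)%:E)%E &
    exists s, state_word y = rcons (state_word x) s].
Proof.
case: x => P j okx Fx; pose xa : state := (P, j.+1).
have wa : state_word xa = rcons (state_word (P, j)) true.
  by rewrite /state_word block_word_a.
have [/andP[pj lj]|nb] := boolP (prime j.+1 && (last 0 P < j.+1)%N); last first.
  exists xa; split=> //; last by exists true.
  have e : primepi (state_max xa) = primepi (state_max (P, j)).
    rewrite /state_max /=; have [jl|] := boolP (j.+1 <= last 0%N P)%N.
      by rewrite (maxn_idPl jl) (maxn_idPl (ltnW jl)).
    rewrite -ltnNge => lj; move: nb; rewrite lj andbT => /negPf nj.
    rewrite !(maxn_idPr _) //; last exact: ltnW.
    by rewrite primepiS nj addn0.
  rewrite /state_flow e -/(state_flow C (P, j)).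
  apply: le_lt_trans Fx; rewrite wa; apply: le_cutset_sum => d [pe be].
  by split=> //; apply: below_rcons be.
pose xb : state := (rcons P j.+1, 0%N).
have wb : state_word xb = rcons (state_word (P, j)) false.
  by rewrite /state_word block_word_b.
have okb : state_ok xb.
  move: okx => /andP[/= PP Ps]; rewrite /state_ok /= all_rcons pj PP /=.
  by case: (P) Ps lj => //= p Q; rewrite rcons_path => ->.
have m1 : state_max (P, j) = j by rewrite /state_max /= (maxn_idPr _).
have m2 : state_max xa = j.+1 by rewrite /state_max /= (maxn_idPr _) // ltnW.
have m3 : state_max xb = j.+1 by rewrite /state_max /= last_rcons maxn0.
have half y : state_max y = j.+1 -> state_flow C y = state_flow C (P, j) / 2.
  move=> my; rewrite /state_flow my m1 primepiS pj natrD mulrDl mul1r.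
  rewrite addrAC opprD expRD [expR (- ln 2)]expRN lnK //.
  by rewrite posrE.
have [Fa|Fa] := ltP (mass_below lambda pi (state_word xa)) (state_flow C xa)%:E.
  by exists xa; split=> //; exists true.
have [Fb|Fb] := ltP (mass_below lambda pi (state_word xb)) (state_flow C xb)%:E.
  by exists xb; split=> //; exists false.
have := le_lt_trans (mass_below_children _ _ _) Fx.
rewrite -wa -wb => /(le_lt_trans (leeD Fa Fb)).
by rewrite (half _ m2) (half _ m3) -EFinD -splitr ltxx.
Qed.

(** If the sum were smaller, the word [b] would have less mass below it than flow
    through it, and the deficit could be followed along a ray; the edge of the
    cutset on this ray would contradict [state_flow_le_mass]. *)
Lemma cutset_sum_ge (R : realType) (lambda C : R) pi :
  primepi_dominates lambda C -> @cutsets lex_tree pi ->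
  ((expR (- C))%:E <= cutset_sum lambda pi)%E.
Proof.
move=> lambdaC pi_cut.
rewrite leNgt; apply/negP => small.
pose inv x := state_ok x /\
  (mass_below lambda pi (state_word x) < (state_flow C x)%:E)%E.
(* the word [b]: the subtree carrying the flow starts with this letter *)
pose x0 : state := ([::], 0%N).
have inv0 : inv x0.
  split=> //; rewrite /state_flow /state_max /= /primepi big_geq // mul0r add0r.
  by apply: le_lt_trans small; apply: le_cutset_sum => e [].
have /choice[f fP] (x : state) : exists y, inv x ->
    inv y /\ exists s, state_word y = rcons (state_word x) s.
  have [[okx Fx]|nx] := pselect (inv x); last by exists x.
  by have [y [oky Fy xy]] := mass_deficit_child okx Fx; exists y.
pose X n := iter n f x0.
have invX n : inv (X n).
  by elim: n => [|n IHn] //=; case: (fP _ IHn).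
pose w n := if n is n'.+1 then state_word (X n') else [::].
have rw n : represents (w n) (word_mx (w n)).
  case: n => [|n] /=; last by apply: state_represents; case: (invX n).
  by rewrite /word_mx big_nil; exact: represents_nil.
have wS n : exists s, w n.+1 = rcons (w n) s.
  by case: n => [|n] /=; [exists false | case: (fP _ (invX n))].
have rayw := word_ray (erefl : w 0%N = [::]) rw wS.
have [sub_pi /(_ _ rayw)[e [[pe te] _]]] := pi_cut.
have [i ei] := ray_traverses rayw (sub_pi _ pe) te.
have [oki Fi] := invX i.
by have := state_flow_le_mass lambdaC oki pe (congr1 snd ei); rewrite leNgt Fi.
Qed.

(** * Comparison of growth rates *)

Lemma powRD_gt0 (R : realType) (x r s : R) :
  0 < x -> x `^ (r + s) = x `^ r * x `^ s.
Proof. by move=> x0; rewrite powRD // (gt_eqF x0) implybT. Qed.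

(** The two sides without [C] cross where [x^(b - a) = A]; the left-hand side at
    this point serves as [C]. *)
Lemma powR_dominated (R : realType) (a b A : R) : 0 <= a -> a < b -> 0 <= A ->
  exists C, forall x, 1 <= x -> A * x `^ a <= x `^ b + C.
Proof.
move=> a0 ab A0; exists (A * (A `^ (b - a)^-1) `^ a) => x x1.
have x0 : 0 < x by lra.
have ba : 0 < b - a by lra.
have [Ax|xA] := leP A (x `^ (b - a)).
  have -> : x `^ b = x `^ (b - a) * x `^ a.
    by rewrite -powRD_gt0 // subrK.
  rewrite -[leLHS]addr0 lerD ?ler_wpM2r ?powR_ge0 //.
  by rewrite mulr_ge0 ?powR_ge0.
rewrite -[leLHS]add0r lerD ?powR_ge0 // ler_wpM2l //.
have xA1 : x <= A `^ (b - a)^-1.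
  have -> : x = (x `^ (b - a)) `^ (b - a)^-1.
    by rewrite -powRrM mulfV ?gt_eqF // powRr1 // ltW.
  by apply: ge0_ler_powR; rewrite ?nnegrE ?powR_ge0 ?invr_ge0 // ltW.
by apply: ge0_ler_powR; rewrite // nnegrE ?powR_ge0 // ltW.
Qed.

Lemma ln_le_powR (R : realType) (d x : R) : 0 < d -> 0 < x -> ln x <= x `^ d / d.
Proof.
move=> d0 x0; rewrite ler_pdivlMr // mulrC -ln_powR.
by apply/ltW/ln_sublinear/powR_gt0.
Qed.

Lemma powR_sqr (R : realType) (x l : R) : 0 <= x -> (x ^+ 2) `^ l = x `^ (2 * l).
Proof. by move=> x0; rewrite powRrM powR_mulrn. Qed.

Lemma chebyshev_ln (R : realType) N :
  (N./2)%:R * ln 2 <= (primepi N)%:R * ln N.+2%:R :> R.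
Proof.
set n := N./2; case: (posnP n) => [->|n0].
  by rewrite mul0r mulr_ge0 // ln_ge0 // ler1n.
have nN : (n + n <= N)%N by rewrite addnn -[leqRHS]odd_double_half leq_addl.
have le : (2 ^ n <= N.+2 ^ primepi N)%N.
  apply: leq_trans (exp2_le_primepi n0) _.
  apply: (@leq_trans (N.+2 ^ primepi (n + n))%N).
    by case: (primepi (n + n)%N) => // k; rewrite leq_exp2r //; lia.
  by rewrite leq_pexp2l // leq_primepi.
rewrite !mulr_natl -!lnXn ?ltr0n // -!natrX ler_ln ?posrE ?ltr0n ?expn_gt0 //.
by rewrite ler_nat.
Qed.

(** Chebyshev's bound [primepi N >= c x / ln x], with [x = N + 2], is weakened to
    [c' x^(1 - e)] by [ln x <= x^e / e].  As [d^l <= x^(2 l)], any positive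
    [e < 1 - 2 l] will do. *)
Lemma primepi_growth (R : realType) (l : R) : 0 < l -> l < 1 / 2 ->
  exists C, primepi_dominates l C.
Proof.
move=> l0 l12; pose e := (1 - 2 * l) / 2; pose g : R := ln 2.
have e0 : 0 < e by rewrite /e; lra.
have g0 : 0 < g by rewrite /g ln_gt0 // ltr1n.
pose K := e * g ^+ 2 / 2.
have K0 : 0 < K by rewrite /K divr_gt0 // mulr_gt0 // exprn_gt0.
have [|||C hC] := @powR_dominated _ (2 * l) (1 - e) K^-1;
  rewrite ?invr_ge0 ?(ltW K0) //.
- lra.
- rewrite /e; lra.
exists (3 * K + K * C) => N d dN; set x : R := N.+2%:R.
have x1 : 1 <= x by rewrite ler1n.
have x0 : 0 < x by lra.
have hd : d%:R `^ l <= x `^ (2 * l).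
  rewrite -powR_sqr ?(ltW x0) // -natrX.
  by apply: ge0_ler_powR; rewrite ?nnegrE ?ler0n ?ler_nat ?(ltW l0).
apply: le_trans hd _.
have h1 : x `^ (2 * l) <= K * x `^ (1 - e) + K * C.
  have := hC x x1; rewrite -(ler_pM2l K0) mulrA mulfV ?gt_eqF // mul1r.
  by rewrite mulrDr.
have h2 : (x - 3) / 2 * g <= (primepi N)%:R * (x `^ e / e).
  apply: (@le_trans _ _ ((N./2)%:R * g)).
    rewrite ler_wpM2r ?(ltW g0) // ler_pdivrMr // lerBlDr -natrM -natrD ler_nat.
    by have := odd_double_half N; rewrite -muln2; case: (odd N) => /=; lia.
  apply: le_trans (chebyshev_ln _ N) _; rewrite ler_wpM2l //.
  by apply: ln_le_powR.
have xe1 : 1 <= x `^ e by rewrite -(powRr0 x) ler_powR // ltW.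
have xe0 : 0 < x `^ e by lra.
have xE : x `^ (1 - e) * x `^ e = x.
  by rewrite -powRD_gt0 // subrK powRr1 // ltW.
have h3 : K * x `^ (1 - e) <= (primepi N)%:R * g + 3 * K.
  rewrite -(ler_pM2r xe0) -mulrA xE mulrDl.
  have : e * g * ((x - 3) / 2 * g) <= e * g * ((primepi N)%:R * (x `^ e / e)).
    by rewrite ler_wpM2l // mulr_ge0 // ltW.
  have -> : e * g * ((primepi N)%:R * (x `^ e / e)) = (primepi N)%:R * g * x `^ e.
    by field; rewrite gt_eqF.
  have : 3 * K <= 3 * K * x `^ e by rewrite ler_peMr // mulr_ge0 // ltW.
  rewrite /K; lra.
rewrite -/g; lra.
Qed.

(** The logarithm of the number of vertices is of order [s ln s], hence at most
    [A s^(1 + e)] with [1 + e < 2 l].  As [(A + 1) s^(1 + e)] is still at most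
    [s^(2 l) + C], the sum is at most [exp(C - s)]. *)
Lemma level_sum_small (R : realType) (l eps : R) : 1 / 2 < l -> 0 < eps ->
  exists2 s, (0 < s)%N &
    (2 * (s ^ 2).+1 ^ (s + s).+2)%:R * expR (- ((s ^ 2)%:R `^ l)) <= eps.
Proof.
move=> l12 eps0; pose e := (2 * l - 1) / 2.
have e0 : 0 < e by rewrite /e; lra.
pose A := 5 * (2 * (2 `^ e / e)).
have A0 : 0 <= A by rewrite /A !mulr_ge0 ?powR_ge0 ?invr_ge0 ?ltW.
have [|||C hC] := @powR_dominated _ (1 + e) (2 * l) (A + 1).
- lra.
- rewrite /e; lra.
- lra.
(* [exp(C - s) <= exp C / (1 + s)], which is at most [eps] for [s >= y] *)
pose y := expR C / eps; have y0 : 0 < y by rewrite divr_gt0 ?expR_gt0.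
pose s := (Num.bound y).+1; exists s => //; set x : R := s%:R.
have x1 : 1 <= x by rewrite ler1n.
have x0 : 0 < x by lra.
have yx : y < x.
  apply: lt_trans (archi_boundP (ltW y0)) _; by rewrite ltr_nat.
have xe : x `^ (1 + e) = x * x `^ e.
  by rewrite powRD_gt0 // powRr1 // ltW.
have xe1 : 1 <= x `^ e by rewrite -(powRr0 x) ler_powR // ltW.
have hl : ln (s ^ 2).+1%:R <= 2 * (2 `^ e / e) * x `^ e.
  apply: (@le_trans _ _ (ln ((2 * x) ^+ 2))).
    rewrite ler_ln ?posrE ?ltr0n ?exprn_gt0 ?mulr_gt0 //.
    rewrite /x -natrM -natrX ler_nat; lia.
  rewrite lnXn ?mulr_gt0 // -[_ *+ 2]mulr_natl -mulrA ler_wpM2l //.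
  apply: le_trans (ln_le_powR e0 _) _; first by rewrite mulr_gt0.
  by rewrite powRM ?(ltW x0) // mulrAC.
have hK : (2 * (s ^ 2).+1 ^ (s + s).+2)%:R <= expR (A * x `^ (1 + e)) :> R.
  apply: (@le_trans _ _ ((s ^ 2).+1 ^ (s + s).+3)%:R).
    by rewrite ler_nat [leqRHS]expnS leq_mul2r ltnS expn_gt0 orbT.
  rewrite natrX -[X in X ^+ _]lnK ?posrE ?ltr0n // -expRM_natl ler_expR xe.
  rewrite /A.
  apply: (@le_trans _ _ (5 * x * (2 * (2 `^ e / e) * x `^ e))); last by lra.
  have s5 : (s + s).+3%:R <= 5 * x by rewrite /x -natrM ler_nat; lia.
  by apply: ler_pM => //; rewrite ln_ge0 // ler1n.
have := hC x x1; rewrite -powR_sqr ?(ltW x0) // -natrX => h.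
apply: (@le_trans _ _ (expR (C - x))).
  apply: (@le_trans _ _ (expR (A * x `^ (1 + e)) * expR (- (s ^ 2)%:R `^ l))).
    by rewrite ler_wpM2r ?expR_ge0.
  rewrite -expRD ler_expR.
  have : x <= x `^ (1 + e) by rewrite xe ler_peMr // ltW.
  lra.
rewrite expRD expRN ler_pdivrMr ?expR_gt0 //.
have := expR_ge1Dx x; have : expR C < eps * x by rewrite -ltr_pdivrMl // mulrC.
move=> h1 h2; apply: le_trans (ltW h1) _; rewrite ler_wpM2l ?ltW //; lra.
Qed.

(** * The branching number *)

Theorem proposition4p7 (R : realType) : IBN R lex_tree = (1 / 2)%:E.
Proof.
have lowerP (l : R) : 0 < l -> l < 1 / 2 -> IBN_set lex_tree l.
  move=> l0 l12; split=> //; have [C hC] := primepi_growth l0 l12.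
  apply: (@lt_le_trans _ _ (expR (- C))%:E); first by rewrite lte_fin expR_gt0.
  by apply: le_ereal_inf_tmp => _ [pi pic <-]; apply: cutset_sum_ge hC pic.
have upperP (l : R) : IBN_set lex_tree l -> l <= 1 / 2.
  move=> [l0 inf0]; rewrite leNgt; apply/negP => l12.
  have : (ereal_inf [set cutset_sum l pi | pi in @cutsets lex_tree] <= 0)%E.
    apply/lee_addgt0Pr => eps eps0; rewrite add0e.
    have [s s0 hs] := level_sum_small l12 eps0.
    apply: le_trans (_ : (cutset_sum l (level (s ^ 2)) <= _)%E); last first.
      by apply: le_trans (level_sum_le l s) _; rewrite lee_fin.
    apply: ereal_inf_lbound; exists (level (s ^ 2)) => //.
    have -> : (s ^ 2 = (s ^ 2).-1.+1)%N by rewrite prednK // expn_gt0 s0.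
    exact: level_cutset.
  by rewrite leNgt inf0.
rewrite /IBN; case: eqP => [e0|_].
  have : IBN_set lex_tree (1 / 4 : R) by apply: lowerP; lra.
  by rewrite e0.
apply/eqP; rewrite eq_le; apply/andP; split.
  by apply: ge_ereal_sup => _ [l /upperP hl <-]; rewrite lee_fin.
apply/lee_subgt0Pr => eps eps0.
pose l : R := Num.max (1 / 2 - eps) (1 / 4).
have [l1 l2] : 1 / 2 - eps <= l /\ 1 / 4 <= l by rewrite !le_max !lexx orbT.
have l3 : l < 1 / 2 by rewrite gt_max; apply/andP; split; lra.
apply: (@le_trans _ _ l%:E); first by rewrite -EFinB lee_fin.
by apply: ereal_sup_ubound; exists l => //; apply: lowerP => //; lra.
Qed.
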